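(* There is a constant $c>0$ such that for all sufficiently large integers $m$ and $n$ there exist a convex polygon $K$ in $\mathbb{R}^2$ with $m$ sides and a set $S$ of $n$ sites in $\operatorname{int}(K)$, in general position with respect to $K$, such that the Hilbert Voronoi diagram $\mathrm{Vor}_K(S)$ has combinatorial complexity at least $c\,mn$; that is, the combinatorial complexity is $\Omega(mn)$.
   Context: Hilbert metric: for a convex body $K$ and distinct $p,q\in\operatorname{int}(K)$, let $x,y$ be the endpoints of the chord of $K$ through $p$ and $q$, in the order $\langle x,p,q,y\rangle$; then $d(p,q)=H_K(p,q)=\frac12\ln\frac{\|p-y\|\,\|q-x\|}{\|q-y\|\,\|p-x\|}$, and $H_K(p,p)=0$. Voronoi diagram: for a finite set $S\subset\operatorname{int}(K)$ (the sites), the Voronoi cell of $p\in S$ is $V(p)=\{q\in K: d(q,p)\le d(q,p')\ \forall p'\in S\setminus\{p\}\}$. Points $q\in\partial K$ are infinitely far from all interior points; relative distances to two sites are compared at such $q$ by taking limits of interior points tending to $q$ (so cells are taken together with their limit points on $\partial K$). $\mathrm{Vor}_K(S)$ is the cell complex of $K$ induced by the cells $V(p)$, $p\in S$. The intersection of two cells $V(p)$ and $V(p')$, if nonempty, is a portion of the $(p,p')$-bisector $\{z\in K: d(z,p)=d(z,p')\}$ and is called a Voronoi edge. The intersection of two Voronoi edges, if nonempty, is called a Voronoi vertex. Sectors and bisector segments: for a point $p\in\operatorname{int}(K)$, the $m$ chords of $K$ through $p$ and each vertex of $K$ subdivide $K$ into at most $2m$ triangular regions, called the sectors of $p$. The points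 of a $(p,p')$-bisector (or Voronoi edge) are grouped according to the sector of $p$ and the sector of $p'$ containing them; the resulting subarcs are called bisector segments. The combinatorial complexity of the diagram is its total number of cells, Voronoi vertices, Voronoi edges, and bisector segments over all Voronoi edges. General position: for any two distinct sites and any two distinct edges of $K$, the line through the two sites and the two lines extending the edges are not concurrent at a common point (and are not all three parallel). *)

(* Defs.v *)
From mathcomp Require Import all_boot all_order all_algebra finmap.
From mathcomp Require Import all_classical all_reals all_analysis.

Set Implicit Arguments.
Unset Strict Implicit.
Unset Printing Implicit Defensive.

Import Order.TTheory GRing.Theory Num.Theory.
Import numFieldNormedType.Exports.

Local Open Scope classical_set_scope.
Local Open Scope ring_scope.

Section Plane.
Context {R : realType}.
Notation point := ('rV[R]_2).

(* The library norm on 'rV[R]_2 is the sup norm; it induces the same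
   topology. *)
Definition euclid_norm (u : point) : R := Num.sqrt (\sum_(i < 2) u 0 i ^+ 2).

Definition cross (u v : point) : R := u 0 0 * v 0 1 - u 0 1 * v 0 0.

Definition line (a b : point) : set point :=
  [set z | exists t : R, z = a + t *: (b - a)].

(* The vertices are listed counterclockwise: every other vertex lies strictly
   to the left of the side from [w i] to its cyclic successor, so that there
   are exactly [m] vertices and [m] sides. *)
Definition convex_position (m : nat) (w : 'I_m -> point) : Prop :=
  (2 < m)%N /\
  forall i j : 'I_m, j != i -> j != ordS i ->
    0 < cross (w (ordS i) - w i) (w j - w i).

Definition polygon (m : nat) (w : 'I_m -> point) : set point :=
  [set x | exists a : 'I_m -> R,
     [/\ forall i, 0 <= a i, \sum_i a i = 1 & x = \sum_i a i *: w i]].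

(* The last point of the convex body [K] on the ray from [p] through [q]. *)
Definition chord_end (K : set point) (p q : point) : point :=
  p + sup [set t : R | K (p + t *: (q - p))] *: (q - p).

Definition hilbert (K : set point) (p q : point) : R :=
  if p == q then 0 else
  let x := chord_end K q p in
  let y := chord_end K p q in
  2^-1 * ln ((euclid_norm (p - y) * euclid_norm (q - x)) /
             (euclid_norm (q - y) * euclid_norm (p - x))).

(* The metric is finite only on the interior of [K]; the closure adds the
   points of the boundary that are limits of interior points of the cell. *)
Definition cell (K S : set point) (p : point) : set point :=
  closure [set q | K° q /\
    forall p', S p' -> p' <> p -> hilbert K q p <= hilbert K q p'].

Definition voronoi_cells (K S : set point) : set (set point) :=
  [set cell K S p | p in S].

Definition voronoi_edges (K S : set point) : set (set point) :=
  [set E | exists p p', [/\ S p, S p', p <> p',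
     E = cell K S p `&` cell K S p' & E !=set0]].

Definition voronoi_vertices (K S : set point) : set (set point) :=
  [set X | exists E E', [/\ voronoi_edges K S E, voronoi_edges K S E', E <> E',
     X = E `&` E' & X !=set0]].

(* The sectors of [p], taken without the chords bounding them: a point off the
   chords lies in exactly one sector, and the points where an edge crosses a
   chord do not make up degenerate bisector segments of their own. *)
Definition sectors (m : nat) (w : 'I_m -> point) (p : point) :
    set (set point) :=
  let U := polygon w `\` \bigcup_i (line p (w i) `&` polygon w) in
  [set connected_component U z | z in U].

Definition bisector_segments (m : nat) (w : 'I_m -> point) (S : set point) :
    set (set point) :=
  [set A | exists p p' s s' z,
     let G := cell (polygon w) S p `&` cell (polygon w) S p' `&` s `&` s' in
     [/\ [/\ S p, S p' & p <> p'], sectors w p s, sectors w p' s',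
         G z & A = connected_component G z]].

(* [counting] is the cardinality of a finite set, and [+oo] otherwise. *)
Definition complexity (m : nat) (w : 'I_m -> point) (S : set point) : \bar R :=
  let K := polygon w in
  (counting (voronoi_cells K S) + counting (voronoi_vertices K S) +
   counting (voronoi_edges K S) + counting (bisector_segments w S))%E.

Definition general_position (m : nat) (w : 'I_m -> point) (S : set point) :
    Prop :=
  forall (p q : point) (i j : 'I_m), S p -> S q -> p <> q -> i <> j ->
    line p q `&` line (w i) (w (ordS i)) `&` line (w j) (w (ordS j)) = set0 /\
    ~ (cross (q - p) (w (ordS i) - w i) = 0 /\
       cross (q - p) (w (ordS j) - w j) = 0).

End Plane.

(* Main.v *)
(* Take K inscribed in the unit circle and symmetric about the horizontal axis,
   and put the sites in mirrored pairs (i eps, h), (i eps, - h) with h much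
   smaller than eps. By symmetry both sites of a pair are at the same Hilbert
   distance from every point of the axis, and a point of the axis within O(h) of
   a pair is closer to that pair than to any other site. On such a short piece
   of the axis, the chords from (i eps, h) through the vertices of the lower half
   of K cut out about m / 2 gaps, and each gap contributes one bisector segment.
   General position holds because, for all sufficiently small eps and then h,
   finitely many polynomials that are affine in eps or h, and not identically
   zero, do not vanish. *)
Require Import Defs.
From mathcomp Require Import all_boot all_order all_algebra finmap.
From mathcomp Require Import all_classical all_reals all_analysis.
From mathcomp Require Import ring lra zify.

Set Implicit Arguments.
Unset Strict Implicit.
Unset Printing Implicit Defensive.

Import Order.TTheory GRing.Theory Num.Theory.
Import numFieldNormedType.Exports.

Local Open Scope classical_set_scope.
Local Open Scope ring_scope.

(** * Elementary arithmetic *)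

Lemma ler1_natr_dist (R : realDomainType) (a b : nat) :
  a != b -> 1 <= `|a%:R - b%:R : R|.
Proof.
rewrite neq_ltn ler_normr => /orP[] ab; apply/orP.
- by right; rewrite opprB lerBrDr addrC natr1 ler_nat.
- by left; rewrite lerBrDr addrC natr1 ler_nat.
Qed.

Lemma half_ltn (n a : nat) : (a < n)%N -> (a./2 < n)%N.
Proof. by move=> an; rewrite (leq_ltn_trans _ an) // -divn2 leq_div. Qed.

Lemma half_doubleS (i : nat) : i.*2.+1./2 = i.
Proof. exact: uphalf_double. Qed.

(** * Plane coordinates, reflection in the horizontal axis, and cross products *)

Section Coordinates.
Context {R : realType}.
Implicit Types (x y e : R) (p q u v z : 'rV[R]_2).

Definition pt x y : 'rV[R]_2 := \row_j (if j == 0 then x else y).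

Lemma pt0 x y : pt x y 0 0 = x.
Proof. by rewrite mxE. Qed.

Lemma pt1 x y : pt x y 0 1 = y.
Proof. by rewrite mxE. Qed.

Lemma row2P u v : u 0 0 = v 0 0 -> u 0 1 = v 0 1 -> u = v.
Proof.
move=> e0 e1; apply/rowP => -[[|[|k]] hk] //.
- by rewrite (_ : Ordinal hk = 0) //; apply: val_inj.
- by rewrite (_ : Ordinal hk = 1) //; apply: val_inj.
Qed.

Definition flip p : 'rV[R]_2 := pt (p 0 0) (- p 0 1).

Lemma flip_x p : flip p 0 0 = p 0 0.
Proof. exact: pt0. Qed.

Lemma flip_y p : flip p 0 1 = - p 0 1.
Proof. exact: pt1. Qed.

(* Unfolding [flip] during unification makes rewriting diverge. *)
Opaque flip.

Lemma flip_pt x y : flip (pt x y) = pt x (- y).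
Proof. by apply: row2P; rewrite (flip_x, flip_y) !(pt0, pt1). Qed.

Lemma flipK : involutive flip.
Proof. by move=> p; apply: row2P; rewrite !(flip_x, flip_y) ?opprK. Qed.

Lemma flipD u v : flip (u + v) = flip u + flip v.
Proof. by apply: row2P; rewrite !(flip_x, flip_y, mxE) ?opprD. Qed.

Lemma flipB u v : flip (u - v) = flip u - flip v.
Proof. by apply: row2P; rewrite !(flip_x, flip_y, mxE) // opprD. Qed.

Lemma flipZ (a : R) u : flip (a *: u) = a *: flip u.
Proof. by apply: row2P; rewrite !(flip_x, flip_y, mxE) ?mulrN. Qed.

Lemma flip_sum (I : finType) (F : I -> 'rV[R]_2) :
  flip (\sum_i F i) = \sum_i flip (F i).
Proof.
have flip0 : flip 0 = 0 by apply: row2P; rewrite !(flip_x, flip_y, mxE) ?oppr0.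
exact: (big_morph flip flipD flip0).
Qed.

Lemma cross_line (p v u : 'rV[R]_2) : line p v u -> cross (v - p) (u - p) = 0.
Proof. by move=> [t ->]; rewrite /cross !mxE; ring. Qed.

Lemma cross_eq0_scale (d g : 'rV[R]_2) :
  d != 0 -> cross d g = 0 -> exists t, g = t *: d.
Proof.
move=> d0; rewrite /cross => e.
have [x0|x0] := eqVneq (d 0 0) 0; last first.
  exists (g 0 0 / d 0 0); apply: row2P; rewrite mxE ?divfK //.
  apply: (mulfI x0); transitivity (g 0 0 * d 0 1); last by field.
  by move: e; lra.
have y0 : d 0 1 != 0.
  by apply: contra d0 => /eqP y0; apply/eqP/row2P; rewrite ?x0 ?y0 mxE.
exists (g 0 1 / d 0 1); apply: row2P; rewrite mxE ?divfK // x0 mulr0.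
by apply/(mulfI y0); rewrite mulr0; move: e; rewrite x0; lra.
Qed.

Lemma cross_eq0_line (p v u : 'rV[R]_2) : v - p != 0 ->
  cross (v - p) (u - p) = 0 -> line p v u.
Proof.
move=> vp /(cross_eq0_scale vp)[t e].
by exists t; rewrite -e addrC subrK.
Qed.

Lemma cross_flip (u v : 'rV[R]_2) : cross (flip u) (flip v) = - cross u v.
Proof. by rewrite /cross !(flip_x, flip_y); ring. Qed.

Lemma cross_continuous (u p : 'rV[R]_2) :
  continuous (fun q : 'rV[R]_2 => cross u (q - p)).
Proof.
have -> : (fun q : 'rV[R]_2 => cross u (q - p)) =
    (fun q => u 0 0 * (q 0 1 - p 0 1) - u 0 1 * (q 0 0 - p 0 0)).
  by apply/funext => q; rewrite /cross !mxE.
move=> q.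
have coordB k : {for q, continuous (fun q : 'rV[R]_2 => q 0 k - p 0 k)}.
  apply: continuousB; last exact: cst_continuous.
  exact: coord_continuous.
have cstc a : {for q, continuous (fun _ : 'rV[R]_2 => a : R)}.
  exact: cst_continuous.
have c1 := continuousM (cstc (u 0 0)) (coordB 1).
have c0 := continuousM (cstc (u 0 1)) (coordB 0).
exact: (continuousB c1 c0).
Qed.

Lemma coord_le_norm u j : `|u 0 j| <= `|u|.
Proof.
rewrite [leRHS]mx_normrE.
exact: (le_bigmax _ (fun ij => `|u ij.1 ij.2|) (0, j)).
Qed.

Lemma norm_row2_lt u e : 0 < e -> (`|u| < e) = (`|u 0 0| < e) && (`|u 0 1| < e).
Proof.
move=> e0; apply/idP/andP => [ue|[ue0 ue1]].
  by split; apply: le_lt_trans ue; apply: coord_le_norm.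
rewrite [ltLHS]mx_normrE; apply: bigmax_lt => // -[i j] _ /=.
rewrite (ord1 i); case: j => -[|[|k]] hk //.
- by rewrite (_ : Ordinal hk = 0) //; apply: val_inj.
- by rewrite (_ : Ordinal hk = 1) //; apply: val_inj.
Qed.

Lemma euclid_normE u : euclid_norm u = Num.sqrt (u 0 0 ^+ 2 + u 0 1 ^+ 2).
Proof.
rewrite /euclid_norm big_ord_recl big_ord1.
by congr (Num.sqrt (_ + u 0 _ ^+ 2)); apply: val_inj.
Qed.

Lemma euclid_normZ (a : R) u : euclid_norm (a *: u) = `|a| * euclid_norm u.
Proof.
by rewrite !euclid_normE -sqrtr_sqr -sqrtrM ?sqr_ge0 // mulrDr -!exprMn !mxE.
Qed.

Lemma euclid_norm_gt0 u : u != 0 -> 0 < euclid_norm u.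
Proof.
move=> u0; rewrite euclid_normE sqrtr_gt0 lt_def addr_ge0 ?sqr_ge0 // andbT.
apply: contra u0; rewrite paddr_eq0 ?sqr_ge0 // !sqrf_eq0.
by move=> /andP[/eqP u0 /eqP u1]; apply/eqP/row2P; rewrite mxE.
Qed.

Lemma euclid_norm_flip u : euclid_norm (flip u) = euclid_norm u.
Proof.
by rewrite !euclid_normE flip_x flip_y sqrrN.
Qed.

Definition off_chords (m : nat) (w : 'I_m -> 'rV[R]_2) (p : 'rV[R]_2) :=
  polygon w `\` \bigcup_k (line p (w k) `&` polygon w).

(** By the intermediate value theorem on the connected set [C], the cross product would vanish at a
    point of [C], which would then lie on the chord removed from the sector. *)
Lemma sector_one_side (m : nat) (w : 'I_m -> 'rV[R]_2) p u v (k : 'I_m) :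
  connected_component (off_chords w p) u v ->
  0 < cross (w k - p) (u - p) -> cross (w k - p) (v - p) < 0 -> False.
Proof.
move=> [C [Cu CU connC] Cv] up vm.
pose f q := cross (w k - p) (q - p).
have : connected (f @` C).
  apply: connected_continuous_connected => //.
  exact/continuous_subspaceT/cross_continuous.
move/connected_intervalP => itv.
have [] := itv (f v) (f u) _ _ 0.
- by exists v.
- by exists u.
- by rewrite !ltW.
move=> q /CU[Kq] notin fq; apply: notin; exists k => //; split=> //.
have wp : w k - p != 0.
  apply: contraTneq up => ->; rewrite /cross !mxE !mul0r subrr ltxx //.
exact: cross_eq0_line.
Qed.

End Coordinates.

(** * Comparison of Hilbert distances near the origin *)

Section HilbertMetric.
Context {R : realType}.

Lemma ratio_gt0 (s : R) : 1 < s -> 0 < s / (s - 1).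
Proof. by move=> s1; rewrite divr_gt0 ?subr_gt0 // (lt_trans ltr01). Qed.

Lemma ratio_decr (s t : R) : 1 < t -> t < s -> s / (s - 1) < t / (t - 1).
Proof.
move=> t1 ts; rewrite ltr_pdivrMr; last by lra.
rewrite mulrAC ltr_pdivlMr; last by lra.
lra.
Qed.

Lemma scale_gt1 (s d : R) : 0 < d -> d < 16^-1 -> 8^-1 <= s * d -> 1 < s.
Proof. by move=> d0 d1; apply: contraTlt => s1; nra. Qed.

(** The chain is [t * (16 * d) < t * d' <= 2 <= 16 * (s * d)]. *)
Lemma scale_lt (s t d d' : R) :
  1 < t -> 0 < d -> 16 * d < d' -> 8^-1 <= s * d -> t * d' <= 2 -> t < s.
Proof.
move=> t1 d0 dd' sd td'; rewrite -(ltr_pM2r d0); apply: lt_le_trans sd.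
suff : t * (16 * d) < t * d' by lra.
by rewrite ltr_pM2l //; lra.
Qed.

Implicit Types (K : set 'rV[R]_2) (p q : 'rV[R]_2).

Lemma chord_end_flip K p q : (forall z, K z <-> K (flip z)) ->
  chord_end K (flip p) (flip q) = flip (chord_end K p q).
Proof.
have flip_comb t : flip p + t *: (flip q - flip p) = flip (p + t *: (q - p)).
  by rewrite [RHS]flipD flipZ flipB.
move=> Kflip; rewrite /chord_end.
suff -> : [set t | K (flip p + t *: (flip q - flip p))] =
          [set t | K (p + t *: (q - p))] by exact: flip_comb.
apply/funext => t; apply/propext.
by have := Kflip (p + t *: (q - p)); rewrite -(flip_comb t) => -[? ?]; split.
Qed.

Lemma hilbert_flip K p q : (forall z, K z <-> K (flip z)) ->
  hilbert K (flip p) (flip q) = hilbert K p q.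
Proof.
move=> Kflip; rewrite /hilbert (inj_eq (inv_inj flipK)).
have normB_flip u v : euclid_norm (flip u - flip v) = euclid_norm (u - v).
  by rewrite -[flip u - flip v]flipB euclid_norm_flip.
by rewrite (chord_end_flip p q Kflip) (chord_end_flip q p Kflip) !normB_flip.
Qed.

Definition chord_sup K p q : R := sup [set t : R | K (p + t *: (q - p))].

(** The four lengths are [s], [t], [s - 1] and [t - 1] times the length of [q - p], which cancels.
    Only the chord parameters remain, and these can be bounded in the sup norm. *)
Lemma hilbert_chord_sup K p q : p != q ->
  1 < chord_sup K p q -> 1 < chord_sup K q p ->
  hilbert K p q = 2^-1 * ln ((chord_sup K p q / (chord_sup K p q - 1)) *
                             (chord_sup K q p / (chord_sup K q p - 1))).
Proof.
move=> pq; rewrite /hilbert (negbTE pq) /chord_end -!/(chord_sup _ _ _).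
set s := chord_sup K p q; set t := chord_sup K q p => s1 t1.
have -> : p - (p + s *: (q - p)) = s *: (p - q).
  by rewrite opprD addrA subrr sub0r -scalerN opprB.
have -> : q - (q + t *: (p - q)) = t *: (q - p).
  by rewrite opprD addrA subrr sub0r -scalerN opprB.
have -> : q - (p + s *: (q - p)) = (s - 1) *: (p - q).
  by apply: row2P; rewrite !mxE; ring.
have -> : p - (q + t *: (p - q)) = (t - 1) *: (q - p).
  by apply: row2P; rewrite !mxE; ring.
have a0 : euclid_norm (p - q) != 0.
  by rewrite gt_eqF // euclid_norm_gt0 // subr_eq0.
have b0 : euclid_norm (q - p) != 0.
  by rewrite gt_eqF // euclid_norm_gt0 // subr_eq0 eq_sym.
rewrite !euclid_normZ !ger0_norm; try lra.
congr (_ * ln _); field.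
by rewrite a0 b0 !subr_eq0 !gt_eqF.
Qed.

(** The ball of radius [1/8] about [p] stays in the ball of radius [1/4] about the origin, hence in
    [K]; and a point of [K] is at distance at most [1 + 1/8] from [p]. *)
Lemma chord_sup_bounds K p q :
  (forall z, `|z| < 4^-1 -> K z) -> (forall z, K z -> `|z| <= 1) ->
  p != q -> `|p| < 8^-1 ->
  8^-1 <= chord_sup K p q * `|q - p| <= 2.
Proof.
move=> Kin Kout pq p8.
have d0 : 0 < `|q - p| by rewrite normr_gt0 subr_eq0 eq_sym.
have ub : ubound [set t : R | K (p + t *: (q - p))] (2 / `|q - p|).
  move=> t /Kout pt1; rewrite ler_pdivlMr //.
  apply: le_trans (_ : `|t *: (q - p)| <= _).
    by rewrite normrZ ler_wpM2r // ler_norm.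
  rewrite -(addKr p (t *: (q - p))); apply: le_trans (ler_normD _ _) _.
  by rewrite normrN; lra.
have in8 : K (p + (8^-1 / `|q - p|) *: (q - p)).
  apply: Kin; apply: le_lt_trans (ler_normD _ _) _.
  rewrite normrZ ger0_norm; last by rewrite divr_ge0 // invr_ge0.
  by rewrite divfK ?gt_eqF //; lra.
apply/andP; split.
  rewrite -ler_pdivrMr //; apply: (ub_le_sup _ in8).
  by exists (2 / `|q - p|).
rewrite -ler_pdivlMr //; apply: ge_sup ub.
by exists (8^-1 / `|q - p|).
Qed.

(* The factor 16 is the ratio of the two bounds in [chord_sup_bounds]. *)
Lemma hilbert_lt K p q q' :
  (forall z, `|z| < 4^-1 -> K z) -> (forall z, K z -> `|z| <= 1) ->
  `|p| < 32^-1 -> `|q| < 32^-1 -> `|q'| < 32^-1 -> p != q ->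
  16 * `|q - p| < `|q' - p| -> hilbert K p q < hilbert K p q'.
Proof.
move=> Kin Kout pb qb qb' pq far.
have d0 : 0 < `|q - p| by rewrite normr_gt0 subr_eq0 eq_sym.
have d0' : 0 < `|q' - p| by lra.
have pq' : p != q'.
  by apply: contraTneq d0' => ->; rewrite subrr normr0 ltxx.
(* With all points within [1/32], distances are below [1/16], so the lower bound [1/8] forces every
   chord parameter above 1, as the logarithmic formula requires. *)
have near1 (u v : 'rV[R]_2) : `|u| < 32^-1 -> `|v| < 32^-1 -> `|u - v| < 16^-1.
  by move=> u1 v1; apply: le_lt_trans (ler_normB _ _) _; lra.
have b (x y : 'rV[R]_2) : x != y -> `|x| < 32^-1 ->
    8^-1 <= chord_sup K x y * `|y - x| <= 2.
  by move=> xy x1; apply: chord_sup_bounds => //; lra.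
have qp : q != p by rewrite eq_sym.
have qp' : q' != p by rewrite eq_sym.
have e : `|p - q| = `|q - p| by rewrite distrC.
have e' : `|p - q'| = `|q' - p| by rewrite distrC.
have := b _ _ pq pb; have := b _ _ pq' pb.
have := b _ _ qp qb; have := b _ _ qp' qb'; rewrite e e'.
move=> /andP[l1 u1] /andP[l2 u2] /andP[l3 u3] /andP[l4 u4].
have d16 : `|q - p| < 16^-1 by apply: near1.
have d16' : `|q' - p| < 16^-1 by apply: near1.
have c1 := scale_gt1 d0' d16' l1.
have c2 := scale_gt1 d0 d16 l2.
have c3 := scale_gt1 d0' d16' l3.
have c4 := scale_gt1 d0 d16 l4.
rewrite !hilbert_chord_sup // ltr_pM2l ?invr_gt0 //.
rewrite ltr_ln ?posrE; do ?[by apply: mulr_gt0; apply: ratio_gt0].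
(* The product is compared factor by factor, [s / (s - 1)] being decreasing in [s]. *)
apply: ltr_pM.
- exact: ltW (ratio_gt0 c4).
- exact: ltW (ratio_gt0 c2).
- exact: ratio_decr c3 (scale_lt c3 d0 far l4 u3).
- exact: ratio_decr c1 (scale_lt c1 d0 far l2 u1).
Qed.
End HilbertMetric.

(** * Rational parametrization of the unit circle *)

Section CirclePoints.
Context {R : realType}.
Implicit Types (s t a b c d : R).

(** Homogeneous half-angle parametrization: [t / s] is the tangent of half the angle, and [s = 0]
    gives [(- 1, 0)]. *)
Definition circ s t : 'rV[R]_2 :=
  pt ((s ^+ 2 - t ^+ 2) / (s ^+ 2 + t ^+ 2)) (2 * s * t / (s ^+ 2 + t ^+ 2)).

Definition nondeg s t := 0 < s ^+ 2 + t ^+ 2.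

Lemma flip_circ s t : flip (circ s t) = circ s (- t).
Proof. by rewrite /circ flip_pt sqrrN mulrN mulNr. Qed.

Lemma circ_x_le s t : nondeg s t -> `|circ s t 0 0| <= 1.
Proof.
rewrite /nondeg pt0 => n0; rewrite normrM normfV (gtr0_norm n0).
by rewrite ler_pdivrMr // mul1r ler_norml; nra.
Qed.

Lemma circ_y_le s t : nondeg s t -> `|circ s t 0 1| <= 1.
Proof.
rewrite /nondeg pt1 => n0; rewrite normrM normfV (gtr0_norm n0).
rewrite ler_pdivrMr // mul1r ler_norml.
have := sqr_ge0 (s - t); have := sqr_ge0 (s + t); rewrite sqrrB sqrrD; lra.
Qed.

Section Identities.
Variables (s t a b c d : R).
Hypotheses (n1 : nondeg s t) (n2 : nondeg a b) (n3 : nondeg c d).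

Let z1 : s ^+ 2 + t ^+ 2 != 0. Proof. by rewrite gt_eqF. Qed.
Let z2 : a ^+ 2 + b ^+ 2 != 0. Proof. by rewrite gt_eqF. Qed.
Let z3 : c ^+ 2 + d ^+ 2 != 0. Proof. by rewrite gt_eqF. Qed.

(** The orientation of three points of the circle factors into brackets of their parameters, so
    convex position is a matter of the order of the parameters. *)
Lemma cross_circ :
  cross (circ a b - circ s t) (circ c d - circ s t) =
  4 * ((s * b - t * a) * (a * d - b * c) * (s * d - t * c)) /
  ((s ^+ 2 + t ^+ 2) * (a ^+ 2 + b ^+ 2) * (c ^+ 2 + d ^+ 2)).
Proof. by rewrite /cross !mxE /=; field; rewrite z1 z2 z3. Qed.

Lemma circB_x : (circ a b - circ s t) 0 0 =
  - 2 * ((s * b - t * a) * (a * t + s * b)) /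
  ((s ^+ 2 + t ^+ 2) * (a ^+ 2 + b ^+ 2)).
Proof. by rewrite !mxE /=; field; rewrite z1 z2. Qed.

Lemma circB_y : (circ a b - circ s t) 0 1 =
  2 * ((s * b - t * a) * (s * a - t * b)) /
  ((s ^+ 2 + t ^+ 2) * (a ^+ 2 + b ^+ 2)).
Proof. by rewrite !mxE /=; field; rewrite z1 z2. Qed.

Lemma cross_circ0 : cross (circ a b - circ s t) (- circ s t) =
  2 * ((s * b - t * a) * (s * a + t * b)) /
  ((s ^+ 2 + t ^+ 2) * (a ^+ 2 + b ^+ 2)).
Proof. by rewrite /cross !mxE /=; field; rewrite z1 z2. Qed.

End Identities.
End CirclePoints.

(** The side between the parameters [z] and [z + 1] would be horizontal exactly when
    [z * (z + 1) = 1]. *)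
Lemma pronic_neq1 (z : int) : 1 <> z * (z + 1).
Proof.
have [?|[->|[->|?]]] // : z <= -2 \/ z = -1 \/ z = 0 \/ 1 <= z by lia.
all: nia.
Qed.

(** * The symmetric inscribed polygon *)

Section CirclePolygon.
Context {R : realType}.
Variables (m r : nat).
Hypotheses (r2 : (2 <= r)%N) (m_gt : (r.*2 < m)%N) (m_le : (m <= r.*2.+2)%N).

Definition vs (k : nat) : R := if (k <= r.*2)%N then 1 else 0.
Definition vt (k : nat) : R := if (k <= r.*2)%N then k%:R - r%:R else 1.

(* The parameters [t / s] are the integers from [- r] to [r], and infinity
   when [m] is even; the polygon is symmetric about the horizontal axis. *)
Definition vertex (k : 'I_m) : 'rV[R]_2 := circ (vs k) (vt k).

Lemma nondeg_vertex k : nondeg (vs k) (vt k).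
Proof.
rewrite /nondeg /vs /vt; case: ifP => _; last by lra.
by rewrite ltr_wpDr ?sqr_ge0 //; lra.
Qed.

Lemma bracket_gt0 (a b : nat) : (a < b)%N -> (b < m)%N ->
  0 < vs a * vt b - vt a * vs b.
Proof.
move=> ab bm; rewrite /vs /vt; case: (leqP b r.*2) => b2.
  rewrite (leq_trans (ltnW ab) b2).
  have : (a%:R : R) < b%:R by rewrite ltr_nat.
  lra.
have -> : (a <= r.*2)%N by lia.
lra.
Qed.

Lemma ordS_lt (i : 'I_m) : (i.+1 < m)%N -> ordS i = i.+1 :> nat.
Proof. by move=> im /=; rewrite modn_small. Qed.

Lemma ordS_last (i : 'I_m) : i.+1 = m -> ordS i = 0%N :> nat.
Proof. by move=> im /=; rewrite im modnn. Qed.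

(** The sides join consecutive integers, then [r] to infinity and infinity to [- r] when [m] is
    even, or [r] directly to [- r] when [m] is odd. *)
Lemma edge_cases (i : 'I_m) : [\/
  exists2 z : int, (- r%:Z <= z < r%:Z) &
    [/\ vs i = 1, vt i = z%:~R, vs (ordS i) = 1 & vt (ordS i) = z%:~R + 1],
  [/\ vs i = 1, vt i = r%:R, vs (ordS i) = 0 & vt (ordS i) = 1],
  [/\ vs i = 0, vt i = 1, vs (ordS i) = 1 & vt (ordS i) = - r%:R] |
  [/\ i.+1 = m, vs i = 1, vt i = r%:R, vs (ordS i) = 1 &
      vt (ordS i) = - r%:R]].
Proof.
have [im|im] := ltnP i.+1 m.
  rewrite ordS_lt // /vs /vt; have [i2|i2] := leqP i.+1 r.*2.
    rewrite (ltnW i2); apply: Or41; exists (i%:Z - r%:Z); first by lia.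
    by rewrite rmorphB /= -natr1; split => //; ring.
  have -> : (i : nat) = r.*2 by lia.
  rewrite leqnn; apply: Or42; split => //.
  by rewrite -addnn natrD; ring.
have {}im : i.+1 = m by have := ltn_ord i; lia.
rewrite ordS_last // /vs /vt /=; have [i2|i2] := leqP i r.*2.
  have e : (i : nat) = r.*2 by lia.
  apply: Or44; split => //; last by rewrite sub0r.
  by rewrite e -addnn natrD; ring.
by apply: Or43; rewrite sub0r.
Qed.

Lemma r_ge2 : 2 <= r%:R :> R.
Proof. by rewrite (ler_nat _ 2). Qed.

Lemma bracket_edge (i : 'I_m) : vs i * vt (ordS i) - vt i * vs (ordS i) != 0.
Proof.
have r2' := r_ge2.
by case: (edge_cases i) => [[z _ []]|[]|[]|[_]] -> -> -> ->; lra.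
Qed.

Lemma edge_y_neq0 (i : 'I_m) : (vertex (ordS i) - vertex i) 0 1 != 0.
Proof.
rewrite circB_y ?nondeg_vertex // mulf_neq0 ?invr_neq0 ?mulf_neq0 //.
all: rewrite ?bracket_edge ?(gt_eqF (nondeg_vertex _)) ?pnatr_eq0 //.
have r2' := r_ge2.
case: (edge_cases i) => [[z _ []]|[]|[]|[_]] -> -> -> ->; try nra.
rewrite mulr1 subr_eq0 -[z%:~R + 1](intrD _ z 1) -intrM.
by rewrite -[X in X == _]/(1%:~R) eqr_int; apply/eqP/pronic_neq1.
Qed.

(** A side is vertical when its end parameters are opposite; consecutive integers have an odd sum,
    which leaves only the side from [r] to [- r]. Hence at most one side is vertical. *)
Lemma edge_x_eq0 (i : 'I_m) : (vertex (ordS i) - vertex i) 0 0 = 0 -> i.+1 = m.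
Proof.
rewrite circB_x ?nondeg_vertex // => /eqP.
rewrite !mulf_eq0 invr_eq0 mulf_eq0 !(gt_eqF (nondeg_vertex _)) orbF orbF.
rewrite (negbTE (bracket_edge i)) oppr_eq0 pnatr_eq0 /=.
have r2' := r_ge2.
case: (edge_cases i) => [[z _ []]|[]|[]|[im] _ _ _ _] //.
all: move=> -> -> -> -> /eqP e; exfalso; try lra.
have : ((z + (z + 1) : int)%:~R : R) = 0 by rewrite !rmorphD /=; lra.
by move/eqP; rewrite intr_eq0 => /eqP; lia.
Qed.

Lemma edge_origin (i : 'I_m) :
  0 < cross (vertex (ordS i) - vertex i) (- vertex i).
Proof.
rewrite cross_circ0 ?nondeg_vertex // divr_gt0 //; last first.
  by apply: mulr_gt0; apply: nondeg_vertex.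
have r2' := r_ge2; rewrite pmulr_rgt0 //.
by case: (edge_cases i) => [[z _ []]|[]|[]|[_]] -> -> -> ->; nra.
Qed.

(** Depending on the cyclic position of [j], the three brackets of [cross_circ] are all positive or
    exactly two of them are negative. *)
Lemma vertex_convex : convex_position vertex.
Proof.
split; first by lia.
move=> i j ji jSi; rewrite cross_circ ?nondeg_vertex //.
rewrite divr_gt0 //; last first.
  by rewrite mulr_gt0 ?mulr_gt0 //; apply: nondeg_vertex.
rewrite pmulr_rgt0 //.
have jm := ltn_ord j.
have {}ji : (j : nat) != i by [].
have {jSi} : (j : nat) != ordS i by [].
have [im|im] := ltnP i.+1 m.
  rewrite ordS_lt // => jSi.
  have h1 : 0 < vs i * vt i.+1 - vt i * vs i.+1 by apply: bracket_gt0.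
  have [lij|lji] := ltnP i j.
    have h2 : 0 < vs i * vt j - vt i * vs j by apply: bracket_gt0.
    have h3 : 0 < vs i.+1 * vt j - vt i.+1 * vs j by apply: bracket_gt0; lia.
    by rewrite !mulr_gt0.
  have h2 : 0 < vs j * vt i - vt j * vs i by apply: bracket_gt0; lia.
  have h3 : 0 < vs j * vt i.+1 - vt j * vs i.+1 by apply: bracket_gt0; lia.
  rewrite -mulrA mulr_gt0 // -mulrNN mulr_gt0 //; lra.
have {}im : i.+1 = m by have := ltn_ord i; lia.
rewrite ordS_last // => j0.
have h1 : 0 < vs 0 * vt i - vt 0 * vs i by apply: bracket_gt0; lia.
have h2 : 0 < vs j * vt i - vt j * vs i by apply: bracket_gt0; lia.
have h3 : 0 < vs 0 * vt j - vt 0 * vs j by apply: bracket_gt0; lia.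
by rewrite mulrAC mulr_gt0 // -mulrNN mulr_gt0 //; lra.
Qed.

Lemma mirror_subproof (k : 'I_m) :
  ((if (k <= r.*2)%N then r.*2 - k else k) < m)%N.
Proof. by have := ltn_ord k; case: ifP; lia. Qed.

Definition mirror (k : 'I_m) : 'I_m := Ordinal (mirror_subproof k).

Lemma mirrorK : involutive mirror.
Proof.
move=> k; apply: val_inj => /=; case: (leqP k r.*2) => k2.
  by rewrite leq_subr; lia.
by rewrite leqNgt k2.
Qed.

Lemma flip_vertex k : flip (vertex k) = vertex (mirror k).
Proof.
rewrite /vertex flip_circ /vs /vt /=; case: (leqP k r.*2) => k2.
  rewrite leq_subr natrB // -addnn natrD.
  by congr circ; ring.
by rewrite leqNgt k2 /= /circ sqrrN !mulr0 !mul0r.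
Qed.

Lemma polygon_flip z : polygon vertex z <-> polygon vertex (flip z).
Proof.
have half u : polygon vertex u -> polygon vertex (flip u).
  move=> [a [a0 a1 ->]]; exists (a \o mirror); split => //=.
  - by rewrite -a1 [RHS](reindex_inj (inv_inj mirrorK)).
  - rewrite flip_sum (reindex_inj (inv_inj mirrorK)); apply: eq_bigr => i _ /=.
    by rewrite flipZ flip_vertex mirrorK.
by split=> [/half//|/half]; rewrite flipK.
Qed.

Lemma polygon_out z : polygon vertex z -> `|z| <= 1.
Proof.
move=> [a [a0 a1 ->]]; apply: le_trans (ler_norm_sum _ _ _) _.
rewrite -a1; apply: ler_sum => i _; rewrite normrZ ger0_norm //.
rewrite ler_piMr //; apply/ler_addgt0Pr => e e0.
have e1 : 0 < 1 + e by lra.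
by apply/ltW; rewrite norm_row2_lt //; apply/andP; split;
  [have := circ_x_le (nondeg_vertex i)|have := circ_y_le (nondeg_vertex i)];
  rewrite -/(vertex i); lra.
Qed.

Lemma vertex_polygon k : polygon vertex (vertex k).
Proof.
exists (fun i => (i == k)%:R); split => [i||]; first by rewrite ler0n.
- by rewrite (bigD1 k) //= eqxx big1 ?addr0 // => i /negbTE ->.
- rewrite (bigD1 k) //= eqxx scale1r big1 ?addr0 // => i /negbTE ->.
  by rewrite scale0r.
Qed.

Lemma polygon_comb (a b c : R) x y z : 0 <= a -> 0 <= b -> 0 <= c ->
  a + b + c = 1 -> polygon vertex x -> polygon vertex y -> polygon vertex z ->
  polygon vertex (a *: x + b *: y + c *: z).
Proof.
move=> a0 b0 c0 abc [f [f0 f1 ->]] [g [g0 g1 ->]] [h [h0 h1 ->]].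
exists (fun i => a * f i + b * g i + c * h i); split => [i||].
- by rewrite !addr_ge0 ?mulr_ge0.
- by rewrite !big_split /= -!mulr_sumr f1 g1 h1 !mulr1.
- rewrite !scaler_sumr -!big_split /=; apply: eq_bigr => i _.
  by rewrite !scalerDl !scalerA.
Qed.

(** The triangle on the vertices of parameters [0], [2] and [- 2], available because [2 <= r],
    already contains this square. *)
Lemma polygon_in z : `|z| < 4^-1 -> polygon vertex z.
Proof.
rewrite norm_row2_lt ?invr_gt0 // => /andP[].
rewrite !ltr_norml => /andP[x1 x2] /andP[y1 y2].
have l0 : (r < m)%N by lia.
have l1 : (r.+2 < m)%N by lia.
have l2 : (r - 2 < m)%N by lia.
have v0 : vertex (Ordinal l0) = pt 1 0.
  rewrite /vertex /circ /vs /vt /= (_ : (r <= r.*2)%N); last by lia.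
  by rewrite subrr; congr pt; field.
have v1 : vertex (Ordinal l1) = pt (- 3 / 5) (4 / 5).
  rewrite /vertex /circ /vs /vt /= (_ : (r.+2 <= r.*2)%N); last by lia.
  have -> : r.+2%:R - r%:R = 2 :> R by rewrite -[r.+2]addn2 natrD; ring.
  by congr pt; field.
have v2 : vertex (Ordinal l2) = pt (- 3 / 5) (- 4 / 5).
  rewrite /vertex /circ /vs /vt /= (_ : (r - 2 <= r.*2)%N); last by lia.
  have -> : (r - 2)%:R - r%:R = - 2 :> R by rewrite natrB //; ring.
  by congr pt; field.
(* These are the barycentric coordinates of [z] in that triangle. *)
have -> : z = ((5 * z 0 0 + 3) / 8) *: pt 1 0 +
    ((5 - 5 * z 0 0) / 16 + 5 * z 0 1 / 8) *: pt (- 3 / 5) (4 / 5) +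
    ((5 - 5 * z 0 0) / 16 - 5 * z 0 1 / 8) *: pt (- 3 / 5) (- 4 / 5).
  by apply: row2P; rewrite !mxE /=; field.
rewrite -v0 -v1 -v2; apply: polygon_comb; try exact: vertex_polygon; lra.
Qed.

End CirclePolygon.

(** * Affine functions at small positive arguments *)

Section NearZero.
Context {R : realType}.

Lemma near0_gt0 (a b : R) : 0 < a -> \forall h \near 0^'+, 0 < a + b * h.
Proof.
move=> a0; have b0 : 0 < `|b| + 1 by rewrite ltr_wpDl.
near=> h.
have h0 : 0 < h by near: h; exact: nbhs_right_gt.
have : h < a / (`|b| + 1) by near: h; apply: nbhs_right_lt; exact: divr_gt0.
rewrite ltr_pdivlMr // => hb.
have : - `|b| <= b by rewrite lerNl -normrN ler_norm.
nra.
Unshelve. all: by end_near.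
Qed.

(** If [a != 0], the product [a * (a + b * h)] is close to [a ^+ 2], hence positive. *)
Lemma near0_neq0 (a b : R) : a != 0 \/ b != 0 ->
  \forall h \near 0^'+, a + b * h != 0.
Proof.
have [->|a0] := eqVneq a 0.
  case=> // b0; apply: filterS (nbhs_right_gt 0) => h h0.
  by rewrite add0r mulf_neq0 // gt_eqF.
move=> _; have : \forall h \near 0^'+, 0 < a ^+ 2 + (a * b) * h.
  by apply: near0_gt0; rewrite exprn_even_gt0.
apply: filterS => h; apply: contraTneq => abh.
by rewrite expr2 -mulrA -mulrDr abh mulr0 ltxx.
Qed.

End NearZero.

(** * General position of the sites *)

Section GeneralPosition.
Context {R : realType}.
Variables (m r n : nat).
Hypotheses (r2 : (2 <= r)%N) (m_gt : (r.*2 < m)%N) (m_le : (m <= r.*2.+2)%N).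

Let w : 'I_m -> 'rV[R]_2 := vertex r.
Let side (i : 'I_m) : 'rV[R]_2 := w (ordS i) - w i.
(** The line extending the side [i] has the equation [cross (side i) z = A i]; two sides are
    parallel exactly when [D i j = 0]. *)
Let A (i : 'I_m) : R := cross (side i) (w i).
Let D (i j : 'I_m) : R := cross (side i) (side j).
Let Q (i j : 'I_m) : 'rV[R]_2 := A i *: side j - A j *: side i.

Lemma side_cross (i : 'I_m) (z : 'rV[R]_2) :
  line (w i) (w (ordS i)) z -> cross (side i) z = A i.
Proof.
by move=> [t ->]; rewrite /A -/(side i) /cross !mxE; ring.
Qed.

(* Cramer's rule: [Q i j] is the intersection point of the lines extending
   the sides [i] and [j], scaled by [D i j]. *)
Lemma side_meet (i j : 'I_m) (z : 'rV[R]_2) :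
  line (w i) (w (ordS i)) z -> line (w j) (w (ordS j)) z -> D i j *: z = Q i j.
Proof.
move=> /side_cross zi /side_cross zj; rewrite /Q -zi -zj.
by apply: row2P; rewrite /D /cross !mxE; ring.
Qed.

(** Parallel lines with a common point coincide. By strict convexity the ends of the side [j] would
    then be those of the side [i], in reverse order. *)
Lemma parallel_sides_disjoint (i j : 'I_m) (z : 'rV[R]_2) : i <> j ->
  D i j = 0 ->
  line (w i) (w (ordS i)) z -> line (w j) (w (ordS j)) z -> False.
Proof.
move=> ij Dij /side_cross zi /side_cross zj.
have y0 : side j 0 1 != 0 by apply: edge_y_neq0.
have par u : cross (side j) u = A j -> cross (side i) u = A i.
  rewrite -zi -zj => /eqP; rewrite -subr_eq0 => /eqP uz.
  apply/eqP; rewrite -subr_eq0.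
  suff : side j 0 1 * (cross (side i) u - cross (side i) z) = 0.
    by move/eqP; rewrite mulf_eq0 (negbTE y0).
  transitivity (side i 0 1 * (cross (side j) u - cross (side j) z) +
    D i j * (u 0 1 - z 0 1)).
    by rewrite /D /cross; ring.
  by rewrite uz Dij; ring.
have [m3 conv] := @vertex_convex R m r r2 m_gt m_le.
have wj : cross (side i) (w j) = A i by apply: par.
have wSj : cross (side i) (w (ordS j)) = A i.
  by apply: par; rewrite /A /side /cross !mxE; ring.
have on_edge k : cross (side i) (w k) = A i -> k = i \/ k = ordS i.
  move=> ki; have [->|ki1] := eqVneq k i; first by left.
  have [->|ki2] := eqVneq k (ordS i); first by right.
  have := conv i k ki1 ki2.
  rewrite (_ : cross _ _ = cross (side i) (w k) - A i).
    by rewrite ki subrr ltxx.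
  by rewrite /A /side /cross !mxE; ring.
have [/esym//|jSi] := on_edge j wj.
have [Sji|/ordS_inj /esym//] := on_edge _ wSj.
(* Two successor steps return to [i] only on a cycle of length at most 2, whereas [m > 2]. *)
have : (ordS (ordS i) : nat) = i by rewrite -jSi Sji.
have im := ltn_ord i; have [im1|im1] := ltnP i.+1 m.
  have e := ordS_lt im1; have [im2|im2] := ltnP i.+2 m.
    by rewrite ordS_lt ?e; lia.
  by rewrite ordS_last ?e; lia.
have e : (ordS i : nat) = 0%N by apply: ordS_last; lia.
by rewrite ordS_lt ?e; lia.
Qed.

Definition mirror_sign (a : nat) : R := if odd a then - 1 else 1.

Definition site (eps h : R) (a : nat) : 'rV[R]_2 :=
  pt (a./2.+1%:R * eps) (mirror_sign a * h).

(** The midpoints of the mirrored pairs lie strictly inside every side, and no vertical line through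
    a pair passes through the meeting point of two side lines. *)
Definition generic_step (eps : R) :=
  (forall (i : 'I_m) (k : 'I_n),
    0 < cross (side i) (pt (k.+1%:R * eps) 0 - w i)) /\
  (forall (i j : 'I_m) (k : 'I_n), D i j != 0 ->
    Q i j 0 0 != D i j * (k.+1%:R * eps)).

Lemma near_generic_step : \forall eps \near 0^'+, generic_step eps.
Proof.
have inside : \forall eps \near 0^'+, forall (i : 'I_m) (k : 'I_n),
    0 < cross (side i) (pt (k.+1%:R * eps) 0 - w i).
  apply: filter_forall => i; apply: filter_forall => k.
  have o : 0 < cross (side i) (- w i) := @edge_origin R m r r2 m_gt m_le i.
  have := near0_gt0 (- (k.+1%:R * side i 0 1)) o; apply: filterS => eps.
  suff -> : cross (side i) (pt (k.+1%:R * eps) 0 - w i) =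
    cross (side i) (- w i) + - (k.+1%:R * side i 0 1) * eps by [].
  by rewrite /cross; move: (side i) (w i) => u v; rewrite !mxE /=; ring.
suff meet : \forall eps \near 0^'+, forall (i j : 'I_m) (k : 'I_n),
    D i j != 0 -> Q i j 0 0 != D i j * (k.+1%:R * eps).
  by near=> eps; split; near: eps.
apply: filter_forall => i; apply: filter_forall => k.
apply: filter_forall => l; have [->|Dik] := eqVneq (D i k) 0.
  exact: filterE.
have := @near0_neq0 R (Q i k 0 0) (- (D i k * l.+1%:R)).
rewrite oppr_eq0 mulf_neq0 ?pnatr_eq0 // => /(_ (or_intror isT)).
apply: filterS => eps H _; apply: contraNN H; rewrite -subr_eq0 => /eqP <-.
by apply/eqP; ring.
Unshelve. all: by end_near.
Qed.

(** Only sites of different pairs are concerned: the line through a mirrored pair is vertical and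
    does not depend on [h]. *)
Definition generic_height (eps h : R) := forall (a b : 'I_n) (i j : 'I_m),
  a./2 != b./2 ->
  let p := site eps h a in let q := site eps h b in
  cross (q - p) (side i) != 0 /\
  (D i j != 0 -> cross (q - p) (Q i j - D i j *: p) != 0).

(** Both cross products are affine in [h]. The constant term of the first is nonzero because no side
    is horizontal; that of the second vanishes only if the two side lines meet on the axis, and then
    the coefficient of [h] is shown to be nonzero. *)
Lemma near_generic_height eps : 0 < eps -> generic_step eps ->
  \forall h \near 0^'+, generic_height eps h.
Proof.
move=> eps0 [inside _].
apply: filter_forall => a; apply: filter_forall => b.
apply: filter_forall => i; apply: filter_forall => j.
have [_|ab] := eqVneq a./2 b./2; first exact: filterE.
set x := a./2.+1%:R * eps; set y := b./2.+1%:R * eps.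
have xy : y - x != 0.
  have e0 : eps != 0 by rewrite gt_eqF.
  by rewrite subr_eq0 /x /y (inj_eq (mulIf e0)) eqr_nat eqSS eq_sym.
have n1 := @near0_neq0 R ((y - x) * side i 0 1)
  (- (mirror_sign b - mirror_sign a) * side i 0 0).
have n2 := @near0_neq0 R ((y - x) * Q i j 0 1)
  (- ((y - x) * D i j * mirror_sign a +
      (mirror_sign b - mirror_sign a) * (Q i j 0 0 - D i j * x))).
have {}n1 := n1 (or_introl (mulf_neq0 xy (edge_y_neq0 r2 m_gt m_le i))).
have [D0|Dij] := eqVneq (D i j) 0.
  have := n1; apply: filterS => h h1 _; split => //; apply: contra h1.
  move=> /eqP <-; apply/eqP; rewrite /cross.
  by move: (side i) => u; rewrite !mxE /= -/x -/y; ring.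
suff /n2 {}n2 :
    ((y - x) * Q i j 0 1 != 0 \/
      - ((y - x) * D i j * mirror_sign a +
      (mirror_sign b - mirror_sign a) * (Q i j 0 0 - D i j * x)) != 0).
  near=> h => _.
  have h1 : (y - x) * side i 0 1 +
    - (mirror_sign b - mirror_sign a) * side i 0 0 * h != 0 by near: h.
  have h2 : (y - x) * Q i j 0 1 + - ((y - x) * D i j * mirror_sign a +
      (mirror_sign b - mirror_sign a) * (Q i j 0 0 - D i j * x)) * h != 0.
    by near: h.
  split=> [|_]; [apply: contra h1|apply: contra h2];
    move=> /eqP <-; apply/eqP; rewrite /cross;
    move: (side i) (Q i j) (D i j) => u v d; rewrite !mxE /= -/x -/y; ring.
 have [Qy|Qy] := eqVneq (Q i j 0 1) 0; last by left; rewrite mulf_neq0.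
right; rewrite oppr_eq0.
have /= := inside i (Ordinal (half_ltn (ltn_ord a))).
have /= := inside i (Ordinal (half_ltn (ltn_ord b))).
rewrite -/x -/y.
have cross_in t : cross (side i) (pt t 0 - w i) = - side i 0 1 * t - A i.
  by rewrite /A /cross; move: (side i) (w i) => u v; rewrite !mxE /=; ring.
rewrite !cross_in => iny inx.
have AQ : A i * D i j = - side i 0 1 * Q i j 0 0.
  have : cross (side i) (Q i j) = A i * D i j.
    by rewrite /Q /D /cross !mxE; ring.
  by rewrite /cross Qy => <-; ring.
(* The points of the axis with abscissas [x] and [y] lie on the same side of
   the point where the side [i] meets the axis. *)
apply/negP => /eqP bad.
have Ex : (- side i 0 1 * x - A i) * D i j =
    side i 0 1 * (Q i j 0 0 - D i j * x) by rewrite mulrBl AQ; ring.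
have Ey : (- side i 0 1 * y - A i) * D i j =
    side i 0 1 * (Q i j 0 0 - D i j * y) by rewrite mulrBl AQ; ring.
have {}bad : D i j *
  (mirror_sign b * (- side i 0 1 * x - A i) -
   mirror_sign a * (- side i 0 1 * y - A i)) = 0.
  transitivity (side i 0 1 * ((y - x) * D i j * mirror_sign a +
    (mirror_sign b - mirror_sign a) * (Q i j 0 0 - D i j * x))).
    transitivity (mirror_sign b * ((- side i 0 1 * x - A i) * D i j) -
      mirror_sign a * ((- side i 0 1 * y - A i) * D i j)); first by ring.
    by rewrite Ex Ey; ring.
  by rewrite bad mulr0.
move/eqP: bad; rewrite mulf_eq0 (negbTE Dij) /= /mirror_sign => /eqP.
have s0 : side i 0 1 * (x - y) != 0.
  by rewrite mulf_neq0 ?edge_y_neq0 // -oppr_eq0 opprB.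
(* Equal signs give [x = y]; opposite signs make a sum of two positive numbers vanish. *)
by case: odd; case: odd => bad; move/eqP: s0; lra.
Unshelve. all: by end_near.
Qed.

Lemma site_vertical eps h (a b : nat) u : a./2 = b./2 ->
  cross (site eps h b - site eps h a) u =
  - ((mirror_sign b - mirror_sign a) * h) * u 0 0.
Proof. by move=> ab; rewrite /cross !mxE /= ab; ring. Qed.

Lemma mirror_sign_neq (a b : nat) : a != b -> a./2 = b./2 ->
  mirror_sign b - mirror_sign a != 0.
Proof.
move=> ab ab2; have : odd a != odd b.
  apply: contraNneq ab => oab.
  by rewrite -(odd_double_half a) -(odd_double_half b) oab ab2.
by rewrite /mirror_sign; case: odd; case: odd => // _; lra.
Qed.

Lemma sites_general_position eps h (S : set 'rV[R]_2) :
  0 < h -> generic_step eps -> generic_height eps h ->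
  (forall p, S p -> exists a : 'I_n, p = site eps h a) ->
  general_position w S.
Proof.
move=> h0 [_ step] height Ssite p q i j /Ssite[a ->] /Ssite[b ->] pq ij.
have ab : (a : nat) != b by apply: contra_notN pq => /eqP ->.
split.
  rewrite -subset0 => z [[[t zt] zi] zj].
  have Dij : D i j != 0.
    by apply/eqP => /parallel_sides_disjoint; apply; eauto.
  have : cross (site eps h b - site eps h a)
      (Q i j - D i j *: site eps h a) = 0.
    rewrite -(side_meet zi zj) zt /cross;
    move: (site _ _ _) (site _ _ _) => u v.
    by rewrite !mxE; ring.
  have [ab2|ab2] := eqVneq a./2 b./2; last first.
    by apply/eqP; apply: (height a b i j ab2).2.
  (* For a mirrored pair, concurrency would put the abscissa of the pair at that of the meeting
     point, which [generic_step] excludes. *)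
  apply/eqP; rewrite site_vertical // mulf_neq0 //.
    by rewrite oppr_eq0 mulf_neq0 ?mirror_sign_neq // gt_eqF.
  have := step i j (Ordinal (half_ltn (ltn_ord a))) Dij; rewrite -subr_eq0.
  by rewrite !mxE.
move=> [] /eqP; have [ab2|ab2] := eqVneq a./2 b./2; last first.
  by rewrite (negbTE (height a b i j ab2).1).
have c0 : - ((mirror_sign b - mirror_sign a) * h) != 0.
  by rewrite oppr_eq0 mulf_neq0 ?mirror_sign_neq // gt_eqF.
rewrite site_vertical // mulf_eq0 (negbTE c0) => /eqP.
(* Both sides would be vertical, but there is at most one such side. *)
move=> /(edge_x_eq0 r2 m_gt m_le) im /eqP.
rewrite site_vertical // mulf_eq0 (negbTE c0) => /eqP.
move=> /(edge_x_eq0 r2 m_gt m_le) jm; apply: ij; apply: val_inj => /=.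
by have [] := etrans im (esym jm).
Qed.

End GeneralPosition.

(** * Lower bounds on cardinalities *)

Section Counting.
Context {R : realType}.

Lemma card_imfset_fin (T : choiceType) (I : finType) (f : I -> T) :
  injective f -> #|` [fset f i | i in I]%fset| = #|I|.
Proof.
move=> f_inj; rewrite card_imfset // cardE; apply/perm_size/uniq_perm.
- exact: enum_finmem_uniq.
- exact: enum_uniq.
- by move=> x; rewrite enum_finmemE.
Qed.

(** An infinite [A] counts as [+oo], which meets the bound at once. *)
Lemma counting_ge (T : choiceType) (I : finType) (f : I -> T) (A : set T) :
  injective f -> (forall i, A (f i)) -> ((#|I|%:R : R)%:E <= counting A)%E.
Proof.
move=> f_inj Af; rewrite /counting; case: asboolP => [Afin|_];
  last by rewrite leey.
rewrite lee_fin ler_nat -(card_imfset_fin f_inj).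
apply: fsubset_leq_card; apply/fsubsetP => x /imfsetP[i _ ->].
by rewrite in_fset_set // inE.
Qed.

Lemma counting_ge0 (T : choiceType) (A : set T) : (0 <= counting A :> \bar R)%E.
Proof. by rewrite /counting; case: ifP. Qed.

End Counting.

(** * Directions separated by the chords through the vertices *)

Section Tilt.
Context {R : realType}.
Variables (m r : nat).
Hypotheses (r2 : (2 <= r)%N) (m_gt : (r.*2 < m)%N) (m_le : (m <= r.*2.+2)%N).

(* From the point [(x, h)], the chord through the vertex of parameter [t]
   crosses the axis at about [x + h * (t - t^-1) / 2] when [x] and [h] are
   small. A [slope] is the value of [(t - t^-1) / 2] at a negative half-integer,
   halfway between two consecutive vertices. *)
Definition slope (j : nat) : R :=
  (- (j%:R + 3 / 2) + (j%:R + 3 / 2)^-1) / 2.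

(* Gives the sign of [cross_witness] for small [eps] and [h]. *)
Definition tilt (k : 'I_m) (j : nat) : R :=
  - vertex r k 0 0 - vertex r k 0 1 * slope j.

(** The zeros, at the parameters [- (j + 3/2)] and [1 / (j + 3/2)], are antipodal points of the
    circle; the factors make the sign at each vertex visible. *)
Lemma tiltE (k : 'I_m) (j : nat) : tilt k j =
  (vt r k + (j%:R + 3 / 2) * vs r k) * (vt r k - vs r k / (j%:R + 3 / 2)) /
  (vs r k ^+ 2 + vt r k ^+ 2).
Proof.
have n0 := gt_eqF (@nondeg_vertex R r k).
have j0 : (0 : R) <= j%:R by rewrite ler0n.
rewrite /tilt /slope pt0 pt1; field.
by rewrite n0 /= gt_eqF //; lra.
Qed.

(** The second zero of [tilt], equal to [2 / (2 j + 3)], is therefore never an integer, that is,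
    never the parameter of a vertex. *)
Lemma odd_mul_neq2 (z : int) (j : nat) : z * (2 * j%:Z + 3) <> 2.
Proof.
have [?|[->|?]] : z <= -1 \/ z = 0 \/ 1 <= z by lia.
- nia.
- by rewrite mul0r.
- nia.
Qed.

Lemma tilt_neq0 (k : 'I_m) (j : nat) : tilt k j != 0.
Proof.
have j0 : (0 : R) <= j%:R by rewrite ler0n.
have u0 : j%:R + 3 / 2 != 0 :> R by rewrite gt_eqF //; lra.
rewrite tiltE; apply: mulf_neq0.
  2: by rewrite invr_eq0 (gt_eqF (@nondeg_vertex R r k)).
rewrite /vs /vt; case: ifP => _;
  last by rewrite mulr0 mul0r addr0 subr0 mulr1 oner_neq0.
rewrite mulr1 mulf_neq0 //.
  apply/eqP => e; have : ((k%:Z - r%:Z) * 2 + (2 * j%:Z + 3))%:~R = 0 :> R.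
    by rewrite !(rmorphD, rmorphM, rmorphN) /=; lra.
  by move/eqP; rewrite intr_eq0 => /eqP; lia.
rewrite subr_eq0 eq_sym -(inj_eq (mulIf u0)) mulfVK //.
apply/eqP => e.
have : ((k%:Z - r%:Z) * (2 * j%:Z + 3))%:~R = 2%:~R :> R.
  by rewrite !(rmorphD, rmorphM, rmorphN) /=; lra.
by move/eqP; rewrite eqr_int => /eqP /odd_mul_neq2.
Qed.

Lemma tilt_separate (j j' : nat) : (j < j')%N -> (j.+2 <= r)%N ->
  exists k : 'I_m, 0 < tilt k j /\ tilt k j' < 0.
Proof.
move=> jj' jr; have km : (r - j.+2 < m)%N by lia.
(* This vertex has parameter [- (j + 2)], which lies between the zeros [- (j + 3/2)] and
   [- (j' + 3/2)]. *)
exists (Ordinal km); rewrite !tiltE /vs /vt /=.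
have -> : (r - j.+2 <= r.*2)%N by lia.
have -> : (r - j.+2)%:R - r%:R = - (j%:R + 2) :> R.
  by rewrite natrB // -[j.+2]addn2 natrD; ring.
have j0 : (0 : R) <= j%:R by rewrite ler0n.
have j1 : (j%:R : R) + 1 <= j'%:R by rewrite natr1 ler_nat.
have inv_pos (x : R) : 0 < x + 3 / 2 -> 0 < (x + 3 / 2)^-1 by rewrite invr_gt0.
have v1 := inv_pos j%:R; have v2 := inv_pos j'%:R.
have d0 : 0 < (1 ^+ 2 + (- (j%:R + 2)) ^+ 2 : R)^-1.
  by rewrite invr_gt0 ltr_wpDr ?sqr_ge0 //; lra.
split; last rewrite -oppr_gt0 -mulNr.
  by apply: mulr_gt0 => //; rewrite -mulrNN mulr_gt0 //; lra.
by apply: mulr_gt0 => //; rewrite -mulrN mulr_gt0 //; lra.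
Qed.

(* Lying on the axis of symmetry, it is equidistant from the mirrored sites
   [i.*2] and [i.*2.+1]. *)
Definition witness (eps h : R) (i j : nat) : 'rV[R]_2 :=
  pt (i.+1%:R * eps + h * slope j) 0.

Lemma cross_witness (eps h : R) (i j : nat) (k : 'I_m) :
  cross (vertex r k - site eps h i.*2) (witness eps h i j - site eps h i.*2) =
  h * (tilt k j + i.+1%:R * eps + slope j * h).
Proof.
rewrite /tilt /cross /witness /site /mirror_sign odd_double doubleK.
by move: (vertex r k) => v; rewrite !mxE /=; ring.
Qed.

End Tilt.

(** * Bisector segments through the witnesses *)

Section Witnesses.
Context {R : realType}.
Variables (m r n : nat) (eps h : R).
Hypotheses (r2 : (2 <= r)%N) (m_gt : (r.*2 < m)%N) (m_le : (m <= r.*2.+2)%N).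
Hypotheses (eps0 : 0 < eps) (h0 : 0 < h) (eps_small : n%:R * eps < 64^-1).
(** Near a witness, its own pair is within [(|slope j| + 2) * h] and every other site is farther
    than [eps / 2]; the factor [32 = 2 * 16] yields the ratio 16 of [hilbert_lt]. *)
Hypothesis h_small : forall j : 'I_r, 32 * (`|slope j| + 2) * h < eps.
(** The corrections in [eps] and [h] do not change the sign of [tilt]. *)
Hypothesis tilt_sign : forall (k : 'I_m) (i : 'I_n) (j : 'I_r),
  0 < tilt r k j * (tilt r k j + i.+1%:R * eps + slope j * h).

Let w : 'I_m -> 'rV[R]_2 := vertex r.
Let K := polygon w.
Let s (a : nat) := site eps h a.
Let z (i j : nat) := witness eps h i j.
Variable S : set 'rV[R]_2.
Hypothesis S_site : forall p, S p <-> exists a : 'I_n, p = s a.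

Lemma polygon_interior (p : 'rV[R]_2) : `|p| < 32^-1 -> K° p.
Proof.
move=> p32; apply/nbhs_ballP; exists 8^-1 => //= q.
rewrite -ball_normE /= => pq; apply: polygon_in => //.
rewrite -(subrK p q); apply: le_lt_trans (ler_normD _ _) _.
by rewrite distrC; lra.
Qed.

Lemma h_lt (j : nat) : (j < r)%N -> 32 * (`|slope j| + 2) * h < eps.
Proof. by move=> jr; apply: (h_small (Ordinal jr)). Qed.

Lemma abscissa_bounds (i : nat) : (i < n)%N ->
  0 < i.+1%:R * eps < 64^-1 /\ eps < 64^-1 /\ h < 64^-1 / 64.
Proof.
move=> lt_in; have n1 : (1 : R) <= n%:R by rewrite (ler_nat _ 1); lia.
have in_n : i.+1%:R * eps <= n%:R * eps by rewrite ler_pM2r // ler_nat.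
have e1 : eps <= n%:R * eps by rewrite ler_peMl // ltW.
have := h_lt (ltnW r2 : (0 < r)%N).
have := normr_ge0 (slope 0 : R); move: (`|slope 0|) => c c0 hc.
have e64 := le_lt_trans e1 eps_small.
split; first by rewrite mulr_gt0 ?ltr0n //= (le_lt_trans in_n eps_small).
split=> //.
have ch : 0 <= c * h by rewrite mulr_ge0 // ltW.
lra.
Qed.

Lemma norm_mirror_sign (a : nat) : `|mirror_sign a * h| = h.
Proof.
by rewrite /mirror_sign; case: odd; rewrite ?mul1r ?mulN1r ?normrN gtr0_norm.
Qed.

Lemma site_norm (a : nat) : (a < n)%N -> `|s a| < 32^-1.
Proof.
move=> /half_ltn /abscissa_bounds [/andP[x0 x1] [e1 h1]].
rewrite norm_row2_lt ?invr_gt0 // pt0 pt1 norm_mirror_sign gtr0_norm //.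
by apply/andP; split; lra.
Qed.

(** The comparison is made on a whole neighbourhood of the witness because cells are closures:
    excluding the witness from a cell requires a ball free of its points. *)
Lemma site_near_lt (i j a b : nat) (q : 'rV[R]_2) :
  (i < n)%N -> (j < r)%N -> (a < n)%N -> (b < n)%N -> b./2 = i -> a./2 != i ->
  `|q - z i j| < h / 2 -> hilbert K q (s b) < hilbert K q (s a).
Proof.
move=> lt_in jr an bn bi ai.
rewrite norm_row2_lt ?divr_gt0 // => /andP[].
rewrite !mxE /= subr0 => qx qy.
have [/andP[x0 x1] [e1 h1]] := abscissa_bounds lt_in.
have hj := h_lt jr; have hp := h0.
have hs : `|h * slope j| = h * `|slope j| by rewrite normrM gtr0_norm.
have hs0 : 0 <= h * `|slope j| by rewrite mulr_ge0 // ltW.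
have qx' : `|q 0 0 - i.+1%:R * eps| < h * `|slope j| + h / 2.
  rewrite -hs (_ : _ - _ = h * slope j +
    (q 0 0 - (i.+1%:R * eps + h * slope j))); last by ring.
  by apply: le_lt_trans (ler_normD _ _) _; rewrite ltrD2l.
have sb1 : `|s b - q| < h * (`|slope j| + 2).
  rewrite norm_row2_lt; last by rewrite mulr_gt0 // ltr_wpDl.
  rewrite !mxE /= bi distrC; apply/andP; split; first by lra.
  apply: le_lt_trans (ler_normB _ _) _; rewrite norm_mirror_sign; lra.
apply: hilbert_lt; rewrite ?site_norm //.
- exact: polygon_in.
- exact: polygon_out.
- rewrite norm_row2_lt ?invr_gt0 //; apply/andP; split; last by lra.
  rewrite (_ : q 0 0 = q 0 0 - i.+1%:R * eps + i.+1%:R * eps); last by ring.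
  apply: le_lt_trans (ler_normD _ _) _; rewrite (gtr0_norm x0); lra.
(* The ordinate of [q] is below [h / 2] in absolute value, that of a site is [h]. *)
- apply/eqP => qs; move: qy; rewrite qs pt1 norm_mirror_sign; lra.
- apply: (@lt_le_trans _ _ (eps / 2)); first by lra.
  apply: le_trans (coord_le_norm _ 0); rewrite !mxE /=.
  have far : eps <= `|a./2.+1%:R * eps - i.+1%:R * eps|.
    rewrite -mulrBl normrM (gtr0_norm eps0) ler_peMl //; first exact: ltW.
    by apply: ler1_natr_dist; rewrite eqSS.
  have := ler_distD (q 0 0) (a./2.+1%:R * eps) (i.+1%:R * eps); lra.
Qed.

Lemma witness_self (i j : nat) : `|z i j - z i j| < h / 2.
Proof. by rewrite subrr normr0 divr_gt0. Qed.

Lemma witness_norm (i j : nat) : (i < n)%N -> (j < r)%N -> `|z i j| < 32^-1.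
Proof.
move=> lt_in jr; rewrite norm_row2_lt ?invr_gt0 // !mxE /= normr0 invr_gt0.
rewrite ltr0n andbT; have [/andP[x0 x1] [e1 h1]] := abscissa_bounds lt_in.
have hj := h_lt jr; have hp := h0.
apply: le_lt_trans (ler_normD _ _) _.
rewrite (gtr0_norm x0) normrM (gtr0_norm hp); lra.
Qed.

Lemma flip_site (a b : nat) : a./2 = b./2 -> a != b -> flip (s a) = s b.
Proof.
move=> ab2 /mirror_sign_neq /(_ ab2); rewrite /s /site flip_pt ab2.
move=> d0; congr pt; rewrite -mulNr; congr (_ * _).
by move: (d0 R); rewrite /mirror_sign; do 2![case: odd];
  rewrite ?subrr ?eqxx ?opprK.
Qed.

Lemma flip_witness (i j : nat) : flip (z i j) = z i j.
Proof. by rewrite flip_pt oppr0. Qed.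

Lemma hilbert_pair (i j a b : nat) : a./2 = b./2 ->
  hilbert K (z i j) (s a) = hilbert K (z i j) (s b).
Proof.
move=> ab2; have [->//|ab] := eqVneq a b.
rewrite -(flip_site ab2 ab) -{2}(flip_witness i j) hilbert_flip //.
exact: polygon_flip.
Qed.

Lemma witness_cell (i j b : nat) :
  (i < n)%N -> (j < r)%N -> (b < n)%N -> b./2 = i -> cell K S (s b) (z i j).
Proof.
move=> lt_in jr bn bi; apply: subset_closure; split.
  exact/polygon_interior/witness_norm.
move=> p' /S_site[a ->] _; have [ai|ai] := eqVneq a./2 i.
  by rewrite (@hilbert_pair i j b a) // ai.
exact/ltW/(site_near_lt lt_in jr (ltn_ord a) bn bi ai)/witness_self.
Qed.

Lemma witness_notin_cell (i j a b : nat) : (i < n)%N -> (j < r)%N ->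
  (a < n)%N -> (b < n)%N -> b./2 = i -> a./2 != i -> ~ cell K S (s a) (z i j).
Proof.
move=> lt_in jr an bn bi ai /(_ (ball (z i j) (h / 2))) [].
  by apply: nbhsx_ballx; rewrite divr_gt0.
move=> q [[_ closest]]; rewrite -ball_normE /= distrC => qz.
have lt_ba := site_near_lt lt_in jr an bn bi ai qz.
have : hilbert K q (s a) <= hilbert K q (s b).
  apply: closest; first by apply/S_site; exists (Ordinal bn).
  by move=> e; move: lt_ba; rewrite e ltxx.
by rewrite leNgt lt_ba.
Qed.

Lemma cross_witness_neq0 (i : 'I_n) (j : 'I_r) (k : 'I_m) :
  cross (w k - s i.*2) (z i j - s i.*2) != 0.
Proof.
rewrite cross_witness mulf_neq0 //; first by rewrite gt_eqF.
by apply: contraTneq (tilt_sign k i j) => ->; rewrite mulr0 ltxx.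
Qed.

Lemma witness_sector (i : 'I_n) (j : 'I_r) (a : nat) : a./2 = i ->
  off_chords w (s a) (z i j).
Proof.
move=> ai; split.
  by apply: polygon_in => //; have := witness_norm (ltn_ord i) (ltn_ord j); lra.
move=> [k _ [/cross_line e _]]; have [a2|a2] := eqVneq a i.*2.
  by have := cross_witness_neq0 i j k; rewrite -a2 e eqxx.
(* Reflection exchanges the two sites of the pair, fixes the witness and sends the chord through the
   vertex [k] to the one through [mirror k]. *)
have := cross_witness_neq0 i j (mirror r2 m_gt m_le k).
rewrite -[w (mirror _ _ _ _)](flip_vertex r2 m_gt m_le k).
rewrite -(@flip_site a i.*2) //; last by rewrite doubleK.
by rewrite -flip_witness -!flipB cross_flip e oppr0 eqxx.
Qed.

Lemma witness_separated (i : 'I_n) (j j' : 'I_r) : (j.+2 <= r)%N ->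
  (j'.+2 <= r)%N -> j != j' ->
  ~ connected_component (off_chords w (s i.*2)) (z i j) (z i j').
Proof.
have sep (k k' : 'I_r) : (k < k')%N -> (k.+2 <= r)%N ->
    ~ connected_component (off_chords w (s i.*2)) (z i k) (z i k').
  move=> kk' kr comp.
  have [l [lk lk']] := @tilt_separate R m r r2 m_gt m_le k k' kk' kr.
  apply: (sector_one_side comp (k := l)).
  - rewrite cross_witness pmulr_rgt0 //.
    by have := tilt_sign l i k; rewrite pmulr_rgt0.
  - rewrite cross_witness pmulr_rlt0 //.
    by have := tilt_sign l i k'; rewrite nmulr_rgt0.
move=> jr jr' jj' comp.
have [jj|jj|/val_inj jj] := ltngtP j j'.
- exact: (sep j j').
- exact/(sep j' j jj jr')/connected_component_sym.
- by rewrite jj eqxx in jj'.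
Qed.

Definition segment (i j : nat) : set 'rV[R]_2 :=
  connected_component (cell K S (s i.*2) `&` cell K S (s i.*2.+1) `&`
    connected_component (off_chords w (s i.*2)) (z i j) `&`
    connected_component (off_chords w (s i.*2.+1)) (z i j)) (z i j).

Lemma pair_ltn (i : nat) : (i < n./2)%N -> (i.*2.+1 < n)%N.
Proof. by move=> i2; rewrite -(odd_double_half n); lia. Qed.

Lemma segment_witness (i j : nat) : (i < n./2)%N -> (j < r)%N ->
  (cell K S (s i.*2) `&` cell K S (s i.*2.+1) `&`
    connected_component (off_chords w (s i.*2)) (z i j) `&`
    connected_component (off_chords w (s i.*2.+1)) (z i j)) (z i j).
Proof.
move=> i2 jr; have i1 := pair_ltn i2; have i0 := ltnW i1.
have lt_in : (i < n)%N by lia.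
split; [split; [split|]|].
- by apply: witness_cell => //; rewrite doubleK.
- by apply: witness_cell => //; rewrite half_doubleS.
- apply: connected_component_refl.
  by apply: (@witness_sector (Ordinal lt_in) (Ordinal jr)); rewrite doubleK.
- apply: connected_component_refl.
  apply: (@witness_sector (Ordinal lt_in) (Ordinal jr)).
  by rewrite half_doubleS.
Qed.

Lemma bisector_segment (i j : nat) : (i < n./2)%N -> (j < r)%N ->
  bisector_segments w S (segment i j).
Proof.
move=> i2 jr; have i1 := pair_ltn i2; have i0 := ltnW i1.
have lt_in : (i < n)%N by lia.
have in_sector a : a./2 = i -> off_chords w (s a) (z i j).
  exact: (@witness_sector (Ordinal lt_in) (Ordinal jr)).
exists (s i.*2), (s i.*2.+1),
  (connected_component (off_chords w (s i.*2)) (z i j)),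
  (connected_component (off_chords w (s i.*2.+1)) (z i j)), (z i j); split.
- split; [by apply/S_site; exists (Ordinal i0)
         |by apply/S_site; exists (Ordinal i1)|].
  move/rowP/(_ 1); rewrite !pt1 /mirror_sign /= odd_double /=.
  by have hp := h0; lra.
- by exists (z i j) => //; apply: in_sector; rewrite doubleK.
- by exists (z i j) => //; apply: in_sector; rewrite half_doubleS.
- exact: segment_witness.
- by [].
Qed.

(** A segment contains its witness. The cells containing that witness determine [i], and its sector
    with respect to the upper site determines [j]. *)
Lemma segment_inj (i i' j j' : nat) : (i < n./2)%N -> (i' < n./2)%N ->
  (j.+2 <= r)%N -> (j'.+2 <= r)%N ->
  segment i j = segment i' j' -> i = i' /\ j = j'.
Proof.
move=> i2 i2' jr jr' eq_seg.
have lt_in : (i < n)%N by lia.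
have j_r : (j < r)%N := ltnW jr.
have j_r' : (j' < r)%N := ltnW jr'.
have i1 := pair_ltn i2; have i1' := pair_ltn i2'.
have : segment i' j' (z i j).
  by rewrite -eq_seg; apply/connected_component_refl/segment_witness.
move=> /connected_component_sub [[[in_cell _] in_sector] _].
have ii' : i' = i.
  apply/eqP; apply/negPn/negP => /eqP ii'.
  have i'n := ltnW i1'; have i_n := ltnW i1.
  apply: (@witness_notin_cell i j i'.*2 i.*2) in_cell => //.
  - by rewrite doubleK.
  - by rewrite doubleK; apply/eqP.
split=> //; move: in_sector; rewrite ii' => in_sector.
apply/eqP; apply/negPn/negP => jj'.
apply: (@witness_separated (Ordinal lt_in) (Ordinal j_r') (Ordinal j_r)) => //.
by rewrite -val_eqE /= eq_sym.
Qed.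

Lemma complexity_ge : (((n./2 * r.-1)%:R : R)%:E <= complexity w S)%E.
Proof.
(* Separating witnesses requires [j + 2 <= r], whence the range [r.-1]. *)
pose f (ij : 'I_(n./2) * 'I_(r.-1)) := segment ij.1 ij.2.
have f_inj : injective f.
  move=> [i j] [i' j']; rewrite /f /=.
  have jr : (j.+2 <= r)%N by have := ltn_ord j; lia.
  have jr' : (j'.+2 <= r)%N by have := ltn_ord j'; lia.
  case/(segment_inj (ltn_ord i) (ltn_ord i') jr jr').
  by move=> /val_inj -> /val_inj ->.
have f_seg ij : bisector_segments w S (f ij).
  case: ij => i j; apply: bisector_segment => //=.
  by have := ltn_ord j; lia.
have := @counting_ge R _ _ _ _ f_inj f_seg.
rewrite card_prod !card_ord => /le_trans; apply.
by rewrite /complexity leeDr // !adde_ge0 // counting_ge0.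
Qed.

End Witnesses.

(** * Choice of the parameters and conclusion *)

Theorem lemma8 (R : realType) :
  exists2 c : R, 0 < c &
  exists N : nat, forall m n : nat, (N <= m)%N -> (N <= n)%N ->
  exists (w : 'I_m -> 'rV[R]_2) (S : {fset 'rV[R]_2}),
    [/\ convex_position w,
        #|` S|%fset = n,
        [set` S] `<=` (polygon w)°,
        general_position w [set` S] &
        ((c * m%:R * n%:R)%:E <= complexity w [set` S])%E].
Proof.
(* The constant is [1/4 * 1/4], from [m <= 4 * (r - 1)] and [n <= 4 * n./2]; both hold from 8 on. *)
exists (16^-1); first by rewrite invr_gt0.
exists 8%N => m n m8 n8; pose r := (m.-1)./2.
have r2 : (2 <= r)%N by rewrite /r; lia.
have m_gt : (r.*2 < m)%N by rewrite /r; lia.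
have m_le : (m <= r.*2.+2)%N by rewrite /r; lia.
near (0 : R)^'+ => eps.
have eps0 : 0 < eps by near: eps; exact: nbhs_right_gt.
have eps_small : n%:R * eps < 64^-1.
  rewrite -subr_gt0 -mulNr; near: eps; apply: near0_gt0; by rewrite invr_gt0.
have step : generic_step m r n eps by near: eps; exact: near_generic_step.
have tilt_eps (k : 'I_m) (i : 'I_n) (j : 'I_r) :
    0 < tilt r k j * (tilt r k j + i.+1%:R * eps).
  rewrite mulrDr -expr2 [tilt _ _ _ * (_ * _)]mulrA.
  move: k i j; near: eps; do 3![apply: filter_forall => ?].
  by apply: near0_gt0; rewrite exprn_even_gt0 // tilt_neq0.
(* The height is chosen after [eps], since its smallness depends on [eps]. *)
near (0 : R)^'+ => h.
have h0 : 0 < h by near: h; exact: nbhs_right_gt.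
have height : generic_height m r n eps h.
  by near: h; exact: near_generic_height.
have h_small (j : 'I_r) : 32 * (`|slope j| + 2) * h < eps.
  rewrite -subr_gt0 -mulNr; move: j; near: h; apply: filter_forall => j.
  exact: near0_gt0.
have tilt_sign (k : 'I_m) (i : 'I_n) (j : 'I_r) :
    0 < tilt r k j * (tilt r k j + i.+1%:R * eps + slope j * h).
  rewrite mulrDr [tilt _ _ _ * (slope _ * _)]mulrA.
  move: k i j; near: h; do 3![apply: filter_forall => ?].
  exact: near0_gt0.
pose S := [fset site eps h (a : 'I_n) | a in 'I_n]%fset.
have S_site p : [set` S] p <-> exists a : 'I_n, p = site eps h a.
  split=> [/imfsetP[a _ ->]|[a ->]]; first by exists a.
  exact: in_imfset.
have site_inj : injective (fun a : 'I_n => site eps h a).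
  move=> a b /rowP e; apply/val_inj/eqP; have := e 1; have := e 0.
  rewrite !pt0 !pt1 => /(mulIf (lt0r_neq0 eps0))/eqP.
  rewrite eqr_nat eqSS => /eqP ab2 /(mulIf (lt0r_neq0 h0)) sab.
  apply/negPn/negP => /mirror_sign_neq - /(_ R ab2).
  by rewrite sab subrr eqxx.
exists (vertex r), S; split.
- exact: vertex_convex.
- by rewrite card_imfset_fin // card_ord.
- move=> p /S_site[a ->]; apply: polygon_interior => //.
  exact: (site_norm r2 m_gt m_le eps0 h0 eps_small h_small).
- by apply: (sites_general_position r2 m_gt m_le h0 step height) => p /S_site.
apply: le_trans (complexity_ge r2 m_gt m_le eps0 h0 eps_small h_small
  tilt_sign S_site).
rewrite lee_fin natrM.
have rm : m%:R <= 4 * r.-1%:R :> R by rewrite -natrM ler_nat /r; lia.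
have nn : n%:R <= 4 * n./2%:R :> R by rewrite -natrM ler_nat; lia.
move: (ler_pM (ler0n R m) (ler0n R n) rm nn); clear; lra.
Unshelve. all: by end_near.
Qed.
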